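(* Let $M$ be a smooth manifold, $\tau\in\Omega^1(M)$, $\omega\in\Omega^2(M)$, and suppose that $(\tau,\omega)$ is a doublet (i.e. its class is constant on $M$). (A) The following statements are equivalent: (i) the class of the doublet is odd; (ii) $\operatorname{Ker}\omega\not\subset\operatorname{Ker}\tau$; (iii) the doublet has a Reeb vector field. (B) The following statements are equivalent: (i) the class of the doublet is even; (ii) $\operatorname{Ker}\omega\subset\operatorname{Ker}\tau$; (iii) the doublet has a Liouville vector field. Similar statements hold pointwise: for an arbitrary pair $(\tau,\omega)$ of a 1-form and a 2-form (not necessarily of constant class) and any $x\in M$, the following are equivalent: the class of $(\tau_x,\omega_x)$ is odd; $\operatorname{Ker}\omega_x\not\subset\operatorname{Ker}\tau_x$; there is a Reeb vector at $x$. Likewise the following are equivalent: the class of $(\tau_x,\omega_x)$ is even; $\operatorname{Ker}\omega_x\subset\operatorname{Ker}\tau_x$; there is a Liouville vector at $x$.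
   Context: All manifolds and maps are smooth. For a $p$-form $\alpha$, $\operatorname{Ker}\alpha_x=\{v\in T_xM\mid \iota_v\alpha_x=0\}$; inclusions of kernels are understood as inclusions of the corresponding subsets of the tangent bundle. The characteristic distribution of a pair $(\tau,\omega)$ of a 1-form and a 2-form at $x$ is $\mathcal K_{(\tau,\omega)_x}=\operatorname{Ker}\tau_x\cap\operatorname{Ker}\omega_x$; the class of the pair at $x$ is its codimension in $T_xM$. The pair is called a doublet if its class is constant on $M$. A Reeb vector field is a (globally defined, smooth) vector field $R$ with $\iota_R\tau=1$ and $\iota_R\omega=0$. A Liouville vector field is a vector field $\Delta$ with $\iota_\Delta\omega=\tau$. A Reeb vector (Liouville vector) at $x$ is a tangent vector at $x$ satisfying the same relations at $x$. *)

(* Defs.v *)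
From mathcomp Require Import all_boot all_order all_algebra.
From mathcomp Require Import all_classical all_reals all_analysis.

Set Implicit Arguments.
Unset Strict Implicit.
Unset Printing Implicit Defensive.

Import Order.TTheory GRing.Theory Num.Theory.
Import numFieldNormedType.Exports.

Local Open Scope classical_set_scope.
Local Open Scope ring_scope.

(** ** Smooth maps on open subsets of R^n *)

(* [Ck k U f] is the usual class C^k only when [U] is open. *)
Fixpoint Ck (R : realType) (n : nat) (W : normedModType R) (k : nat)
    (U : set 'rV[R]_n) (f : 'rV[R]_n -> W) : Prop :=
  if k is k'.+1 then
    (forall x, U x -> differentiable f x) /\
    (forall v : 'rV[R]_n, Ck k' U ('D_v f))
  else {in U, continuous f}.

Definition smooth_on (R : realType) (n : nat) (W : normedModType R)
    (U : set 'rV[R]_n) (f : 'rV[R]_n -> W) : Prop :=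
  forall k, Ck k U f.

(** ** Smooth manifolds *)

(* The values of [chart_map] outside [chart_dom], and of [chart_inv] outside
   the image of the chart, are irrelevant. *)
Record chart (R : realType) (n : nat) (T : topologicalType) := Chart {
  chart_dom : set T;
  chart_map :> T -> 'rV[R]_n;
  chart_inv : 'rV[R]_n -> T;
  chart_dom_open : open chart_dom;
  chart_img_open : open (chart_map @` chart_dom);
  chart_mapK : {in chart_dom, cancel chart_map chart_inv};
  chart_map_continuous : {in chart_dom, continuous chart_map};
  chart_inv_continuous : {in chart_map @` chart_dom, continuous chart_inv}
}.

Definition chart_img (R : realType) (n : nat) (T : topologicalType)
  (c : chart R n T) : set 'rV[R]_n := c @` chart_dom c.

(* The atlas is not required to be maximal: it determines a maximal one, and
   smoothness on [M] may be tested on any atlas. *)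
Record manifold (R : realType) (n : nat) := Manifold {
  carrier :> topologicalType;
  manifold_hausdorff : hausdorff_space carrier;
  manifold_second_countable : @second_countable carrier;
  atlas : set (chart R n carrier);
  atlas_cover : forall x : carrier, exists2 c, atlas c & chart_dom c x;
  atlas_smooth : forall c d, atlas c -> atlas d ->
    smooth_on (c @` (chart_dom c `&` chart_dom d)) (d \o chart_inv c)
}.

(** ** Tangent vectors, vector fields and differential forms *)

(* A chart of the atlas around [x], chosen once and for all. *)
Definition chart_at (R : realType) (n : nat) (M : manifold R n) (x : M) :
  chart R n M := sval (cid2 (atlas_cover x)).

(* A tangent vector at [x] is represented by its components in the chart
   [chart_at x]; its components in the other charts around [x] are obtained
   from these by [to_chart].  Since [chart_at x] depends on [x] in an arbitrary
   way, smoothness of a field on [M] is never read off the values in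
   [tangent x] directly, but off the components in a fixed chart. *)
Definition tangent (R : realType) (n : nat) (M : manifold R n) (x : M) : Type :=
  'rV[R]_n.

Definition to_chart (R : realType) (n : nat) (M : manifold R n)
    (c : chart R n M) (x : M) (v : tangent x) : 'rV[R]_n :=
  'd (c \o chart_inv (chart_at x)) (chart_at x x) v.

Definition of_chart (R : realType) (n : nat) (M : manifold R n)
    (c : chart R n M) (x : M) (w : 'rV[R]_n) : tangent x :=
  'd (chart_at x \o chart_inv c) (c x) w.

Definition tangent_bundle (R : realType) (n : nat) (M : manifold R n) : Type :=
  {x : M & tangent x}.

Record vector_field (R : realType) (n : nat) (M : manifold R n) := VectorField {
  vf_val :> forall x : M, tangent x;
  vf_smooth : forall c, atlas c ->
    smooth_on (chart_img c)
      (fun y => to_chart c (vf_val (chart_inv c y)))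
}.

Record form1 (R : realType) (n : nat) (M : manifold R n) := Form1 {
  form1_val :> forall x : M, 'Hom(tangent x, R^o);
  form1_smooth : forall c, atlas c -> forall w : 'rV[R]_n,
    smooth_on (chart_img c) (fun y =>
      let x := chart_inv c y in form1_val x (of_chart c x w))
}.

(* A bilinear form [b] on T_xM is encoded as the linear map
   v |-> b(v, -) = iota_v b. *)
Record form2 (R : realType) (n : nat) (M : manifold R n) := Form2 {
  form2_val :> forall x : M, 'Hom(tangent x, 'Hom(tangent x, R^o));
  form2_alt : forall (x : M) (v : tangent x), form2_val x v v = 0;
  form2_smooth : forall c, atlas c -> forall w1 w2 : 'rV[R]_n,
    smooth_on (chart_img c) (fun y =>
      let x := chart_inv c y in
      form2_val x (of_chart c x w1) (of_chart c x w2))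
}.

(** ** Pairs of a 1-form and a 2-form *)

Section Pairs.
Context (R : realType) (n : nat) (M : manifold R n).
Implicit Types (tau : form1 M) (omega : form2 M) (x : M).

Definition Ker1 tau : set (tangent_bundle M) :=
  [set p | projT2 p \in lker (tau (projT1 p))].

Definition Ker2 omega : set (tangent_bundle M) :=
  [set p | projT2 p \in lker (omega (projT1 p))].

Definition char_distr tau omega x : {vspace tangent x} :=
  (lker (tau x) :&: lker (omega x))%VS.

Definition pair_class tau omega x : nat :=
  (\dim (fullv : {vspace tangent x}) - \dim (char_distr tau omega x))%N.

Definition doublet tau omega (k : nat) : Prop :=
  forall x, pair_class tau omega x = k.

Definition Reeb_vector tau omega x (v : tangent x) : Prop :=
  tau x v = 1 /\ omega x v = 0.

Definition Liouville_vector tau omega x (v : tangent x) : Prop :=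
  omega x v = tau x.

Definition Reeb_field tau omega (V : vector_field M) : Prop :=
  forall x, Reeb_vector tau omega (V x).

Definition Liouville_field tau omega (V : vector_field M) : Prop :=
  forall x, Liouville_vector tau omega (V x).

End Pairs.

(* Main.v *)
Require Import Defs.
From mathcomp Require Import all_boot all_order all_algebra.
From mathcomp Require Import all_classical all_reals all_analysis.
From mathcomp Require Import ring lra.

(** Fix a point [x], write [t] for the column of coefficients of [tau] at [x]
    and [A] for the matrix of [omega] at [x].  The class at [x] is the rank of
    the block matrix [(t | A)], that is, the rank of [A], plus one exactly when
    [t] does not vanish on the kernel of [A] ([mxrank_row_mx_cV]).  Since [A]
    is skew-symmetric its rank is even ([skew_rank_even]), so the parity of
    the class decides whether [Ker omega] is contained in [Ker tau]
    ([odd_class]).  A vector of [Ker omega] outside [Ker tau] can be rescaled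
    into a Reeb vector, and if [t] vanishes on the kernel of [A] then, [A]
    being skew, the transpose of [t] lies in the row space of [A], which gives
    a Liouville vector.  This settles the pointwise statements.

    For a doublet, the parity of the constant class makes the same alternative
    hold at every point, and both kinds of vector field are solutions of a
    system [v *m B x = b x] that is solvable at every point and whose matrix
    has constant rank: [B = (t | A)] and [b = (1 | 0)] for Reeb fields, [B = A]
    and [b] the transpose of [t] for Liouville fields.  It remains to find a
    smooth solution of such a system ([smooth_solution]).

    Locally, an invertible minor of [B] at one point, of size the rank, stays
    invertible nearby, and as the rank is constant Cramer's rule for this
    minor gives a smooth solution nearby ([smooth_linear_solve]).  Globally,
    the solutions at a point form an affine space, so local solutions are
    averaged by a partition of unity ([glue_local_solutions]).  Local
    finiteness is obtained without an exhaustion by compact sets: given bump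
    functions [h_0, h_1, ...] such that around each point one of them is
    constantly [1], the functions
    [h_k * (1 - h_0) * ... * (1 - h_(k-1))] sum to one, and all but finitely
    many of them vanish near any given point. *)

Set Implicit Arguments.
Unset Strict Implicit.
Unset Printing Implicit Defensive.

Import Order.TTheory GRing.Theory Num.Theory.
Import numFieldNormedType.Exports.

Local Open Scope classical_set_scope.
Local Open Scope ring_scope.

(** * Calculus of functions of class C^k on open subsets of R^n *)

Lemma near_eq_continuous_at (T S : topologicalType) (f g : T -> S) (x : T) :
  (\near x, f x = g x) -> {for x, continuous f} -> {for x, continuous g}.
Proof.
move=> fg; have fgx : f x = g x by exact: nbhs_singleton fg.
rewrite /prop_for /continuous_at fgx; apply: cvg_trans; exact: near_eq_cvg.
Qed.

Section DifferentiableNear.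
Context (R : realType) (V W : normedModType R).

Let near_eq_expansion (f g : V -> W) (x : V) :
  (\near x, f x = g x) -> differentiable f x ->
  g \o shift x = cst (g x) + 'd f x +o_ (0 : V) id.
Proof.
move=> fg df; apply/eqaddoP => e e0.
have /eqaddoP /(_ e e0) := diff_locally df => H2.
have fgx : f x = g x by exact: nbhs_singleton fg.
move: fg; rewrite (near_shift 0 x) => fg.
apply: filterS2 fg H2 => y; rewrite /= !fctE /= subr0 => ->.
by rewrite fgx.
Qed.

Lemma near_eq_diff (f g : V -> W) (x : V) :
  (\near x, f x = g x) -> differentiable f x -> 'd g x = 'd f x :> (V -> W).
Proof.
move=> fg df; apply: (@diff_unique R V W g ('d f x) x).
  exact: diff_continuous.
exact: near_eq_expansion.
Qed.

Lemma near_eq_differentiable (f g : V -> W) (x : V) :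
  (\near x, f x = g x) -> differentiable f x -> differentiable g x.
Proof.
move=> fg df; apply/diff_locallyP; rewrite (near_eq_diff fg df).
by split; [exact: diff_continuous|exact: near_eq_expansion].
Qed.

End DifferentiableNear.

Section Ck_calculus.
Context (R : realType) (n : nat) (W : normedModType R).
Implicit Types (U : set 'rV[R]_n) (f g : 'rV[R]_n -> W).

(** The derivatives of [f] at the points of an open set depend only on the
    restriction of [f] to it.  In the closure properties below, this allows the
    derivative of a compound function to be computed on [U] only. *)
Lemma Ck_ext k U f g : open U -> (forall x, U x -> f x = g x) ->
  Ck k U f -> Ck k U g.
Proof.
move=> oU; elim: k f g => [|k IH] f g fg /=.
  move=> cf x xU; have Ux : U x by move: xU; rewrite inE.
  apply: near_eq_continuous_at (cf x xU).
  exact: filterS (open_nbhs_nbhs (conj oU Ux)).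
move=> [df Df]; split=> [x Ux|v].
  apply: near_eq_differentiable (df x Ux).
  exact: filterS (open_nbhs_nbhs (conj oU Ux)).
apply: IH (Df v) => x Ux; apply: near_eq_derive.
exact: filterS (open_nbhs_nbhs (conj oU Ux)).
Qed.

Lemma CkW k U f : Ck k.+1 U f -> Ck k U f.
Proof.
elim: k f => [|k IH] f /= [df Df].
  by move=> x; rewrite inE => Ux; exact: differentiable_continuous (df x Ux).
by split=> // v; apply: IH.
Qed.

Lemma Ck_subset k U U' f : U' `<=` U -> Ck k U f -> Ck k U' f.
Proof.
move=> UU'; elim: k f => [|k IH] f /=.
  by move=> cf x; rewrite inE => /UU' Ux; apply: cf; rewrite inE.
by move=> [df Df]; split=> [x /UU' /df //|v]; exact: IH.
Qed.

(** Membership in [Ck] is a condition at each point, so it is inherited by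
    unions of arbitrarily many sets. *)
Lemma Ck_local k U f :
  (forall x, U x -> exists2 U', U' x & Ck k U' f) -> Ck k U f.
Proof.
elim: k f => [|k IH] f H /=.
  by move=> x; rewrite inE => /H[U' U'x]; apply; rewrite inE.
split=> [x /H[U' U'x [df _]]|v]; first exact: df.
by apply: IH => x /H[U' U'x [_ Df]]; exists U' => //; exact: Df.
Qed.

Lemma Ck_cst k U (a : W) : open U -> Ck k U (fun=> a).
Proof.
move=> oU; elim: k a => [|k IH] a /=.
  by move=> x _; exact: cst_continuous.
split=> [x _|v]; first exact: differentiable_cst.
by apply: Ck_ext (IH 0) => // x _; rewrite derive_cst.
Qed.

Lemma CkD k U f g : open U -> Ck k U f -> Ck k U g ->
  Ck k U (fun x => f x + g x).
Proof.
move=> oU; elim: k f g => [|k IH] f g /=.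
  by move=> cf cg x xU; apply: continuousD; [exact: cf|exact: cg].
move=> [df Df] [dg Dg]; split=> [x Ux|v].
  by apply: differentiableD; [exact: df|exact: dg].
apply: Ck_ext (IH _ _ (Df v) (Dg v)) => // x Ux.
by rewrite deriveD //; apply: diff_derivable; [exact: df|exact: dg].
Qed.

Lemma Ck_sum k U (I : Type) (s : seq I) (P : pred I) (F : I -> 'rV[R]_n -> W) :
  open U -> (forall i, P i -> Ck k U (F i)) ->
  Ck k U (fun x => \sum_(i <- s | P i) F i x).
Proof.
move=> oU hF; elim: s => [|i s IH].
  by apply: Ck_ext (Ck_cst k 0 oU) => // x _; rewrite big_nil.
case Pi: (P i); last first.
  by apply: Ck_ext IH => // x _; rewrite big_cons Pi.
by apply: Ck_ext (CkD oU (hF i Pi) IH) => // x _; rewrite big_cons Pi.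
Qed.

Lemma CkZl k U (h : 'rV[R]_n -> R^o) (e : W) : open U ->
  Ck k U h -> Ck k U (fun y => h y *: e).
Proof.
move=> oU; elim: k h => [|k IH] h.
  move=> ch x xU; have {}ch := ch x xU; apply: continuousZr_tmp; exact: ch.
move=> [dh Dh]; split=> [x Ux|v].
  by apply: differentiableZl; exact: dh.
apply: Ck_ext (IH _ (Dh v)) => // x Ux.
rewrite !deriveE ?diffZl //; try exact: dh.
by apply: differentiableZl; exact: dh.
Qed.

End Ck_calculus.

Lemma derive_coord (R : realType) (n m : nat) (f : 'rV[R]_n -> 'rV[R]_m) x v j :
  differentiable f x ->
  'D_v (fun y => f y 0 j : R^o) x = ('D_v f x) 0 j.
Proof.
by move=> df; rewrite (derive_mx (diff_derivable df)) mxE.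
Qed.

Section Ck_scalar.
Context (R : realType) (n : nat).
Implicit Types (U : set 'rV[R]_n) (f g : 'rV[R]_n -> R^o).

Lemma CkM k U f g : open U -> Ck k U f -> Ck k U g ->
  Ck (W := R^o) k U (fun x => f x * g x).
Proof.
move=> oU; elim: k f g => [|k IH] f g.
  by move=> /= cf cg x xU; apply: continuousM; [exact: cf|exact: cg].
move=> cf cg; have cf' := CkW cf; have cg' := CkW cg.
move: cf cg => /= [df Df] [dg Dg]; split=> [x Ux|v].
  by apply: differentiableM; [exact: df|exact: dg].
have := CkD oU (IH _ _ cf' (Dg v)) (IH _ _ cg' (Df v)).
apply: Ck_ext => // x Ux; rewrite [RHS](@deriveM _ _ f g) //.
- exact/diff_derivable/df.
- exact/diff_derivable/dg.
Qed.

Lemma CkN k U f : open U -> Ck k U f -> Ck (W := R^o) k U (fun x => - f x).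
Proof.
move=> oU cf; have := CkM oU (Ck_cst k (-1 : R^o) oU) cf.
by apply: Ck_ext => // x _; rewrite mulN1r.
Qed.

Lemma Ck_prod k U (I : Type) (s : seq I) (P : pred I)
    (F : I -> 'rV[R]_n -> R^o) :
  open U -> (forall i, P i -> Ck k U (F i)) ->
  Ck (W := R^o) k U (fun x => \prod_(i <- s | P i) F i x).
Proof.
move=> oU hF; elim: s => [|i s IH].
  by apply: Ck_ext (Ck_cst k (1 : R^o) oU) => // x _; rewrite big_nil.
case Pi: (P i); last first.
  by apply: Ck_ext IH => // x _; rewrite big_cons Pi.
by apply: Ck_ext (CkM oU (hF i Pi) IH) => // x _; rewrite big_cons Pi.
Qed.

Lemma CkV k U f : open U -> (forall x, U x -> f x != 0) ->
  Ck k U f -> Ck (W := R^o) k U (fun x => (f x)^-1).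
Proof.
move=> oU f0; elim: k => [|k IH].
  move=> /= cf x xU; apply: continuousV; last exact: cf.
  by apply: f0; move: xU; rewrite inE.
move=> cf; have Vf := IH (CkW cf).
move: cf => /= [df Df]; split=> [x Ux|v].
  by apply: differentiableV; [exact: df|exact: f0].
have := CkN oU (CkM oU (CkM oU Vf Vf) (Df v)).
apply: Ck_ext => // x Ux; rewrite [RHS](@deriveV _ _ f) ?f0 //.
  by rewrite /GRing.scale /= -invfM mulNr.
exact/diff_derivable/df.
Qed.

Lemma Ck_coord k (j : 'I_n) U : open U ->
  Ck (W := R^o) k U (fun y : 'rV[R]_n => y 0 j).
Proof.
move=> oU; case: k => [|k].
  by move=> x _; exact: coord_continuous.
split=> [x _|v]; first exact: differentiable_coord.
apply: Ck_ext (Ck_cst k (v 0 j : R^o) oU) => // x _.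
by rewrite (@derive_coord _ _ _ id) ?derive_id //; exact: ex_diff.
Qed.

End Ck_scalar.

Section Ck_vector.
Context (R : realType) (n m : nat).
Implicit Types (U : set 'rV[R]_n).

(** Reduces vector-valued functions to scalar ones, for which products and
    composites are available. *)
Lemma Ck_coordP k U (f : 'rV[R]_n -> 'rV[R]_m) : open U ->
  Ck k U f <-> forall j, Ck (W := R^o) k U (fun y => f y 0 j).
Proof.
move=> oU; split.
  move=> cf j; elim: k f cf => [|k IH] f /=.
    move=> cf x xU; apply: (@continuous_comp _ _ _ f (fun N : 'rV_m => N 0 j)).
      exact: cf.
    exact: coord_continuous.
  move=> [df Df]; split=> [x Ux|v].
    apply: (@differentiable_comp _ _ _ _ f (fun N : 'rV_m => N 0 j)).
      exact: df.
    exact: differentiable_coord.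
  by apply: Ck_ext (IH _ (Df v)) => // x Ux; rewrite derive_coord //; exact: df.
move=> cf; suff: Ck k U (fun x => \sum_j f x 0 j *: (delta_mx 0 j : 'rV[R]_m)).
  by apply: Ck_ext => // x _; rewrite -row_sum_delta.
by apply: Ck_sum => // j _; apply: CkZl.
Qed.

Lemma CkZ k U (f : 'rV[R]_n -> R^o) (g : 'rV[R]_n -> 'rV[R]_m) : open U ->
  Ck k U f -> Ck k U g -> Ck k U (fun x => f x *: g x).
Proof.
move=> oU cf /(Ck_coordP _ _ oU) cg; apply/(Ck_coordP _ _ oU) => j.
by apply: Ck_ext (CkM oU cf (cg j)) => // x _; rewrite mxE.
Qed.

(** The chain rule expresses a directional derivative of [f \o g] as a sum of
    products of components of derivatives of [g] with partial derivatives of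
    [f] composed with [g], to which the induction hypothesis applies. *)
Lemma Ck_comp k U V (g : 'rV[R]_n -> 'rV[R]_m) (f : 'rV[R]_m -> R^o) :
  open U -> open V -> (forall x, U x -> V (g x)) ->
  Ck k U g -> Ck k V f -> Ck (W := R^o) k U (fun x => f (g x)).
Proof.
move=> oU oV UV; elim: k f => [|k IH] f.
  move=> /= cg cf x xU; apply: continuous_comp; first exact: cg.
  by apply: cf; rewrite inE; apply: UV; move: xU; rewrite inE.
move=> cg; have cg' := CkW cg.
move: cg => /= [dg Dg] [df Df]; split=> [x Ux|v].
  by apply: differentiable_comp; [exact: dg|apply: df; exact: UV].
have : Ck (W := R^o) k U (fun x => \sum_j ('D_v g x) 0 j *
    'D_(delta_mx 0 j) f (g x)).
  apply: Ck_sum => // j _; apply: CkM => //.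
    by move: (Dg v) => /(Ck_coordP _ _ oU).
  exact: (IH _ cg' (Df _)).
apply: Ck_ext => // x Ux.
have dfx : differentiable f (g x) by apply/df/UV.
have dgx := dg x Ux.
rewrite [RHS]deriveE; last exact: differentiable_comp.
rewrite diff_comp //= -(deriveE v dgx) [in RHS](row_sum_delta ('D_v g x)).
rewrite linear_sum; apply: eq_bigr => j _.
by rewrite linearZ /= (deriveE _ dfx).
Qed.

End Ck_vector.

(** * A flat function *)

Section Flat.
Context (R : realType).
Implicit Types t : R.

(** The powers of [1 / t] are included because this makes the family stable
    under differentiation up to linear combinations, so that smoothness follows
    by an induction on the order that treats all [m] at once. *)
Definition flat (m : nat) t : R := if 0 < t then t^-1 ^+ m * expR (- t^-1) else 0.

(** With [q = p.+1]: raise [exp (u / q) >= u / q] to the power [q]. *)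
Lemma pow_expRN_le (p : nat) (u : R) : 0 <= u ->
  u ^+ p.+1 * expR (- u) <= p.+1%:R ^+ p.+1.
Proof.
move=> u0; rewrite expRN ler_pdivrMr ?expR_gt0 //.
have -> : expR u = expR (u / p.+1%:R) ^+ p.+1.
  by rewrite -expRM_natl mulrC divfK ?pnatr_eq0.
rewrite -exprMn lerXn2r ?nnegrE ?mulr_ge0 ?expR_ge0 //.
rewrite -ler_pdivrMl ?ltr0Sn // mulrC.
by apply: le_trans (expR_ge1Dx _); rewrite lerDr ler01.
Qed.

(** The quadratic bound contains both the continuity of [flat m] at the origin
    and the vanishing of its derivative there. *)
Lemma flat_le m t : 0 <= flat m t <= m.+2%:R ^+ m.+2 * t ^+ 2.
Proof.
rewrite /flat; case: ltP => t0; last first.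
  by rewrite lexx mulr_ge0 ?sqr_ge0 ?exprn_ge0 ?ler0n.
have V0 : 0 <= t^-1 by rewrite invr_ge0 ltW.
rewrite mulr_ge0 ?exprn_ge0 ?expR_ge0 //=.
rewrite -ler_pdivrMr ?exprn_gt0 //.
have := pow_expRN_le m.+1 V0.
by rewrite 2!exprS; apply: le_trans; rewrite exprVn; lra.
Qed.

Lemma is_derive_flat m t :
  is_derive t 1 (flat m) (flat m.+2 t - m%:R * flat m.+1 t).
Proof.
have [t0|t0|->] := ltgtP t 0.
- apply: (@near_eq_is_derive _ _ _ (cst 0)).
    near=> s; rewrite /flat ltNge le_eqVlt; have -> // : s < 0.
      by near: s; exact: lt_nbhsl.
    by rewrite orbT.
  by rewrite /flat ltNge ltW //= mulr0 subr0; exact: is_derive_cst.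
- apply: (@near_eq_is_derive R R^o R^o (fun s : R => s^-1 ^+ m * expR (- s^-1))).
    near=> s; rewrite /flat; have -> // : 0 < s.
    by near: s; exact: lt_nbhsr.
  have tn0 : t != 0 by rewrite gt_eqF.
  have dV : is_derive t 1 (fun s : R => s^-1) (- t ^- 2 *: 1).
    exact: (@is_deriveV _ id).
  have dE : is_derive t 1 (expR \o (fun s : R => - s^-1))
      (expR (- t^-1) * - (- t ^- 2 *: 1)).
    exact: is_derive1_comp.
  have dX : is_derive t 1 (fun s : R => s^-1 ^+ m)
      (- (m%:R * t^-1 ^+ m.+1)).
    case: m => [|m].
      rewrite mul0r oppr0; under eq_fun do rewrite expr0; exact: is_derive_cst.
    rewrite [X in is_derive _ _ X _](_ : _ = (fun s : R => s^-1) ^+ m.+1);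
      last first.
      by apply/funext => s; rewrite exprfctE.
    have H := @is_deriveX _ _ _ m.+1 t 1 _ dV; apply: (is_derive_eq H).
    rewrite /GRing.scale /= mulr1 mulrN -mulrA; congr (- (_ * _)).
    by rewrite -exprVn -exprD addn2.
  have H := @is_deriveM _ _ _ _ _ _ _ _ dX dE; apply: (is_derive_eq H).
  rewrite /flat t0 /GRing.scale /= mulr1 opprK.
  by rewrite -exprVn !exprSr; ring.
have -> : flat m.+2 0 - m%:R * flat m.+1 0 = 0.
  by rewrite /flat ltxx mulr0 subrr.
suff H : (fun h : R => h^-1 *: (flat m (h *: 1 + 0) - flat m 0)) @ 0^' --> (0 : R).
  by apply: DeriveDef; [apply/cvg_ex; exists 0|exact/cvg_lim].
set C := m.+2%:R ^+ m.+2 : R.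
have C0 : 0 < C by rewrite exprn_gt0.
apply/cvgrPdist_le => e e0; near=> h.
rewrite sub0r normrN /GRing.scale /= mulr1 addr0 [flat m 0]/flat ltxx subr0.
have h0 : h != 0 by near: h; exact: nbhs_dnbhs_neq.
have /andP[F0 F1] := flat_le m h.
rewrite normrM normfV ler_pdivrMl ?normr_gt0 // ger0_norm //.
apply: le_trans F1 _; rewrite -/C -(real_normK (num_real h)) expr2 mulrCA.
rewrite ler_pM2l ?normr_gt0 // -ler_pdivlMl // mulrC.
near: h; apply: dnbhs0_le; by rewrite divr_gt0.
Unshelve. all: by end_near. Qed.

End Flat.

(** * Bump functions on R^n *)

Section Bump.
Context (R : realType) (n : nat).

Lemma Ck_flat k (U : set 'rV[R]_n) m (f : 'rV[R]_n -> R^o) : open U ->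
  Ck k U f -> Ck (W := R^o) k U (fun x => flat m (f x)).
Proof.
move=> oU.
have dfl j t : differentiable (@flat R j : R^o -> R^o) t.
  by apply/derivable1_diffP; case: (is_derive_flat j t).
elim: k m => [|k IH] m.
  move=> cf x xU; apply: continuous_comp; first exact: (cf x xU).
  exact: differentiable_continuous.
move=> cf; have cf' := CkW cf; move: cf => [df Df]; split=> [x Ux|v].
  by apply: differentiable_comp => //; exact: df.
have H1 := CkM oU (Ck_cst k (- m%:R : R^o) oU) (IH m.+1 cf').
apply: Ck_ext (CkM oU (CkD oU (IH m.+2 cf') H1) (Df v)) => // x Ux.
have dfx := df x Ux; have dgx := dfl m (f x).
rewrite [RHS]deriveE; last exact: differentiable_comp.
rewrite [in RHS]diff_comp //= deriv1E; last exact/derivable1_diffP.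
rewrite derive1E (@derive_val _ _ _ _ _ _ _ (is_derive_flat m (f x))).
by rewrite deriveE // mulNr mulrC.
Qed.

(** Since [t] and [1 - t] are never both nonpositive, the denominator is
    positive and the quotient is smooth. *)
Definition step (t : R) : R := flat 0 t / (flat 0 t + flat 0 (1 - t)).

Lemma flat_gt0 m (t : R) : 0 < t -> 0 < flat m t.
Proof. by move=> t0; rewrite /flat t0 mulr_gt0 ?expR_gt0 ?exprn_gt0 ?invr_gt0. Qed.

Lemma flat_le0 m (t : R) : t <= 0 -> flat m t = 0.
Proof. by move=> t0; rewrite /flat ltNge t0. Qed.

Lemma step_den_gt0 (t : R) : 0 < flat 0 t + flat 0 (1 - t).
Proof.
have F s : 0 <= flat 0 s by have /andP[] := flat_le 0 s.
have [t0|t0] := ltP 0 t; first by rewrite ltr_pwDl ?F ?flat_gt0.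
by rewrite addrC; apply: ltr_pwDl; [apply: flat_gt0; lra|exact: F].
Qed.

Lemma step0 t : t <= 0 -> step t = 0.
Proof. by move=> t0; rewrite /step flat_le0 // mul0r. Qed.

Lemma step1 t : 1 <= t -> step t = 1.
Proof.
move=> t1; have := step_den_gt0 t; rewrite /step [flat 0 (1 - t)]flat_le0.
  by rewrite addr0 => ?; rewrite divff ?gt_eqF.
by lra.
Qed.

Lemma smooth_step (f : 'rV[R]_n -> R^o) :
  smooth_on setT f -> smooth_on (W := R^o) setT (fun x => step (f x)).
Proof.
move=> sf k; apply: CkM; first exact: openT.
  by apply: Ck_flat; [exact: openT|].
apply: CkV; first exact: openT.
  by move=> x _; rewrite gt_eqF // step_den_gt0.
apply: CkD; first exact: openT.
  by apply: Ck_flat; [exact: openT|].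
apply: Ck_flat; first exact: openT.
apply: CkD; [exact: openT|exact: (Ck_cst _ _ openT)|].
by apply: CkN; [exact: openT|].
Qed.

Lemma bump_exists (a : 'rV[R]_n) (N : set 'rV[R]_n) : nbhs a N ->
  exists (h : 'rV[R]_n -> R^o) (Z : set 'rV[R]_n),
    [/\ smooth_on setT h, compact Z, Z `<=` N,
        forall y, ~ Z y -> h y = 0 & \forall y \near a, h y = 1].
Proof.
move=> /nbhs_ballP[d /= d0 dN].
pose q (y : 'rV[R]_n) : R^o := 2 - 3 / d ^+ 2 * \sum_i (y 0 i - a 0 i) ^+ 2.
have sq : smooth_on setT q.
  move=> k; apply: CkD; [exact: openT|exact: (Ck_cst _ _ openT)|].
  apply: CkN; first exact: openT.
  apply: CkM; [exact: openT|exact: (Ck_cst _ _ openT)|].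
  apply: Ck_sum; [exact: openT|move=> i _].
  have H : Ck (W := R^o) k setT (fun y : 'rV[R]_n => y 0 i - a 0 i).
    apply: CkD; [exact: openT|exact: (Ck_coord _ _ openT)|].
    exact: (Ck_cst _ _ openT).
  by apply: Ck_ext (CkM openT H H); [exact: openT|].
have cq : continuous q by move=> x; apply: (sq 0); rewrite inE.
have Zball : [set y | 0 <= q y] `<=` ball a d.
  move=> y /=; rewrite /q => qy.
  have Hi i : `|y 0 i - a 0 i| < d.
    rewrite ltNge; apply/negP => di.
    have : d ^+ 2 <= \sum_i (y 0 i - a 0 i) ^+ 2.
      rewrite (bigD1 i) //=; apply: ler_wpDr.
        by apply: sumr_ge0 => j _; exact: sqr_ge0.
      rewrite -(real_normK (num_real (y 0 i - a 0 i))).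
      by rewrite ler_sqr ?nnegrE ?normr_ge0 // ltW.
    rewrite -(@ler_pM2l _ (3 / d ^+ 2)) ?divr_gt0 ?exprn_gt0 //.
    by rewrite divfK ?gt_eqF ?exprn_gt0 // => H; lra.
  split=> // i j; rewrite ord1; apply: le_lt_trans (Hi j).
  by rewrite distrC.
(* [q] exceeds [1] near [a] and is nonnegative only inside the ball of radius
   [d]: the constant [3] leaves a margin over the [2] in the definition of [q]. *)
exists (fun y => step (q y)), [set y | 0 <= q y]; split.
- exact: smooth_step.
- apply: bounded_closed_compact.
    exists (`|a| + d); split; first exact: num_real.
    move=> M Md y /Zball; rewrite -ball_normE /= => ayd.
    apply: ltW; apply: le_lt_trans Md.
    rewrite -[y](subrK a) addrC; apply: le_trans (ler_normD _ _) _.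
    by rewrite lerD2l distrC ltW.
  exact: (closed_comp (fun y _ => cq y) (@closed_ge R 0)).
- by move=> y /Zball /dN.
- move=> y /negP; rewrite -ltNge => /ltW; exact: step0.
have : nbhs a (q @^-1` [set t | 1 < t]).
  apply: cq; apply: open_nbhs_nbhs; split; first exact: open_gt.
  by rewrite /= /q big1 => [|i _]; rewrite ?subrr ?expr0n //= mulr0; lra.
by apply: filterS => y /= /ltW; exact: step1.
Qed.

End Bump.

(** * Skew matrices and linear systems *)

Section SkewRank.
Context (F : numFieldType).

(** In odd size the determinant of a skew matrix equals its own opposite. *)
Lemma skew_unitmx_even r (Y : 'M[F]_r) : Y^T = - Y -> Y \in unitmx -> ~~ odd r.
Proof.
move=> skY; rewrite unitmxE unitfE => dY0; apply/negP => r_odd.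
have := det_tr Y; rewrite skY -scaleN1r detZ -signr_odd r_odd expr1 mulN1r.
move=> /eqP; rewrite eq_sym -addr_eq0 -mulr2n mulrn_eq0 /=.
by rewrite (negbTE dY0).
Qed.

(** A rank factorization of a skew matrix can be made symmetric,
    [A = B^T *m Y *m B] with [B] of full row rank.  Then [Y] is an invertible
    skew matrix whose size is the rank of [A]. *)
Lemma skew_rank_even n (A : 'M[F]_n) : A^T = - A -> ~~ odd (\rank A).
Proof.
move=> skA.
have [r [B [X [fB AX rA]]]] : exists r, exists B : 'M[F]_(r, n),
    exists X : 'M[F]_(n, r),
    [/\ row_free B, A = X *m B & \rank A = r].
  have /submxP[X AX] : (A <= row_base A)%MS by rewrite eq_row_base.
  by exists (\rank A), (row_base A), X; split=> //; exact: row_base_free.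
have [D BD] : exists D, B *m D = 1%:M by apply/row_freeP.
have XE : X = B^T *m - (X^T *m D).
  have : A^T *m D = - X by rewrite skA AX mulNmx -mulmxA BD mulmx1.
  by rewrite AX trmx_mul -mulmxA mulmxN => ->; rewrite opprK.
set Y := - (X^T *m D) in XE.
have AE : A = B^T *m Y *m B by rewrite -XE.
have skY : Y^T = - Y.
  have H : B^T *m (Y^T + Y) *m B = 0.
    rewrite mulmxDr mulmxDl -AE -[X in _ + X]opprK -skA AE !trmx_mul trmxK.
    by rewrite mulmxA subrr.
  have H1 : B^T *m (Y^T + Y) = 0.
    by apply: (row_free_inj fB); rewrite H mul0mx.
  apply/eqP; rewrite -addr_eq0; apply/eqP; apply: trmx_inj.
  by apply: (row_free_inj fB); rewrite trmx0 mul0mx -[B]trmxK -trmx_mul H1 trmx0.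
rewrite rA; apply: (skew_unitmx_even skY); rewrite -row_free_unit /row_free eqn_leq.
rewrite rank_leq_row -[X in (X <= _)%N]rA [X in (\rank X <= _)%N]AE.
by apply: leq_trans (mxrankM_maxl _ _) (mxrankM_maxr _ _).
Qed.

(** Adding the column [t] cuts the left kernel of [A] by one linear condition,
    which is trivial exactly when [t] vanishes on that kernel. *)
Lemma mxrank_row_mx_cV n m (t : 'cV[F]_n) (A : 'M[F]_(n, m)) :
  \rank (row_mx t A) = (\rank A + (kermx A *m t != 0)%R)%N.
Proof.
set B := row_mx t A.
have kBA : (kermx B <= kermx A)%MS.
  apply/sub_kermxP; have := mulmx_ker B.
  by rewrite mul_mx_row -row_mx0 => /eq_row_mx[].
have [kt|kt] := eqVneq (kermx A *m t) 0.
  have kAB : (kermx A <= kermx B)%MS.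
    by apply/sub_kermxP; rewrite mul_mx_row kt mulmx_ker row_mx0.
  have : \rank (kermx A) = \rank (kermx B).
    by apply/eqP; rewrite eqn_leq !mxrankS.
  rewrite !mxrank_ker addn0 => H.
  by rewrite -(subKn (rank_leq_row A)) H subKn // rank_leq_row.
apply/eqP; rewrite eqn_leq; apply/andP; split.
  rewrite -mxrank_tr tr_row_mx -addsmxE.
  apply: leq_trans (mxrank_adds_leqif _ _).1 _.
  by rewrite !mxrank_tr addnC leq_add2l rank_leq_col.
have lt : (kermx B < kermx A)%MS.
  rewrite /ltmx kBA /=; apply: contra kt => kAB; apply/eqP.
  have /sub_kermxP := kAB; rewrite mul_mx_row -row_mx0 => /eq_row_mx[-> _] //.
have := rank_ltmx lt; rewrite !mxrank_ker => H.
rewrite addn1 ltnNge; apply/negP => BA.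
by move: H; rewrite ltnNge leq_sub2l.
Qed.

Lemma dim_kernel n m (B : 'M[F]_(n, m)) (K : {vspace 'rV[F]_n}) :
  (forall v, (v \in K) = (v *m B == 0)) -> \dim K = (n - \rank B)%N.
Proof.
move=> KB; pose X : 'M[F]_(\dim K, n) := \matrix_i (vbasis K)`_i.
have XE u : u *m X = \sum_i u 0 i *: (vbasis K)`_i.
  by rewrite mulmx_sum_row; apply: eq_bigr => i _; rewrite rowK.
have fX : row_free X.
  apply: inj_row_free => u; rewrite XE => u0; apply/rowP => i; rewrite mxE.
  by have /freeP/(_ _ u0 i) := basis_free (vbasisP K).
rewrite -mxrank_ker -(eqP fX); apply/eqP; rewrite eqn_leq !mxrankS //.
  apply/row_subP => i; apply/submxP.
  have : row i (kermx B) \in K by rewrite KB -row_mul mulmx_ker row0.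
  move=> /coord_vbasis ->; exists (\row_j coord (vbasis K) j (row i (kermx B))).
  by rewrite XE; apply: eq_bigr => j _; rewrite mxE.
apply/row_subP => i; apply/sub_kermxP/eqP; rewrite rowK -KB vbasis_mem //.
by rewrite mem_nth // size_tuple.
Qed.

(** [C] and [D] generalize the selection of the rows and columns of an
    invertible minor of maximal size; taking them from a basis of the row space
    turns this minor into the identity. *)
Lemma invertible_minor n m (A : 'M[F]_(n, m)) :
  exists C D, C *m A *m D = (1%:M : 'M[F]_(\rank A)).
Proof.
have [D BD] : exists D, row_base A *m D = 1%:M.
  by apply/row_freeP; exact: row_base_free.
have /submxP[C CE] : (row_base A <= A)%MS by rewrite eq_row_base.
by exists C, D; rewrite -CE.
Qed.

(** Cramer's rule for the minor [C *m A *m D] of maximal size.  Since [A *m D] has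
    the rank of [A], the columns of [A] are combinations of those of [A *m D], so
    that solving the equations selected by [D] solves all of them. *)
Lemma solve_by_minor n m r (A : 'M[F]_(n, m)) (b : 'rV[F]_m) C D :
  \rank A = r -> C *m A *m D \in @unitmx _ r -> (b <= A)%MS ->
  b *m D *m invmx (C *m A *m D) *m C *m A = b.
Proof.
move=> rA uS /submxP[u ->].
have rD : \rank (A *m D) = \rank A.
  apply/eqP; rewrite eqn_leq mxrankM_maxl /= rA.
  rewrite -{1}(mxrank_unit uS) -mulmxA; exact: mxrankM_maxr.
have [X AX] : exists X, A = A *m D *m X.
  have : ((A *m D)^T == A^T)%MS.
    rewrite -(geq_leqif (mxrank_leqif_eq _)) ?mxrank_tr ?rD //.
    by rewrite trmx_mul submxMl.
  move=> /andP[_ /submxP[Y /(congr1 trmx)]]; rewrite trmxK trmx_mul trmxK => H.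
  by exists Y^T.
set S := C *m A *m D in uS *.
have H : C *m A = S *m X by rewrite [in LHS]AX !mulmxA.
rewrite -mulmxA H [_ *m (S *m X)]mulmxA mulmxKV //.
by rewrite -[u *m A *m D]mulmxA -[_ *m X]mulmxA -AX.
Qed.

End SkewRank.

(** * The pointwise equivalences *)

Section Pointwise.
Context (F : numFieldType) (n : nat).
Implicit Types (al : 'Hom('rV[F]_n, F^o)) (om : 'Hom('rV[F]_n, 'Hom('rV[F]_n, F^o))).

Definition hom1_cV al : 'cV[F]_n := \col_i al (delta_mx 0 i).
Definition hom2_mx om : 'M[F]_n := \matrix_(i, j) om (delta_mx 0 i) (delta_mx 0 j).

Lemma hom1E al v : al v = (v *m hom1_cV al) 0 0.
Proof.
rewrite [in LHS](row_sum_delta v) linear_sum mxE; apply: eq_bigr => i _.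
by rewrite linearZ mxE.
Qed.

Lemma hom2E om v w : om v w = (v *m hom2_mx om *m w^T) 0 0.
Proof.
rewrite [in LHS](row_sum_delta w) linear_sum mxE; apply: eq_bigr => j _.
rewrite linearZ !mxE mulrC; congr (_ * _).
rewrite [in LHS](row_sum_delta v) linear_sum /= sum_lfunE; apply: eq_bigr => i _.
by rewrite linearZ /= scale_lfunE !mxE.
Qed.

Lemma hom2_rVE om v : v *m hom2_mx om = \row_j om v (delta_mx 0 j).
Proof.
by apply/rowP => j; rewrite [RHS]mxE hom2E trmx_delta -colE [RHS]mxE.
Qed.

Lemma mem_lker1 al v : (v \in lker al) = (v *m hom1_cV al == 0).
Proof.
rewrite memv_ker hom1E; apply/eqP/eqP => [H|->]; last by rewrite mxE.
by apply/matrixP => i j; rewrite !ord1 H mxE.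
Qed.

Lemma mem_lker2 om v : (v \in lker om) = (v *m hom2_mx om == 0).
Proof.
rewrite memv_ker; apply/eqP/eqP => [H|H].
  by rewrite hom2_rVE H; apply/rowP => j; rewrite !mxE lfunE.
by apply/lfunP => w; rewrite hom2E H mul0mx mxE lfunE.
Qed.

Lemma alt_antisym om : (forall v, om v v = 0) ->
  forall v w, om v w = - om w v.
Proof.
move=> alt v w; have := alt (v + w).
rewrite !linearD /= !add_lfunE !alt add0r addr0 => /eqP.
by rewrite addrC addr_eq0 => /eqP.
Qed.

Lemma hom2_mx_skew om : (forall v, om v v = 0) -> (hom2_mx om)^T = - hom2_mx om.
Proof. by move=> alt; apply/matrixP => i j; rewrite !mxE alt_antisym. Qed.

Lemma sub_lkerE al om :
  (lker om <= lker al)%VS = (kermx (hom2_mx om) *m hom1_cV al == 0).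
Proof.
apply/subvP/eqP => [H|H v].
  apply/row_matrixP => i; rewrite row_mul row0; apply/eqP; rewrite -mem_lker1.
  by apply: H; rewrite mem_lker2 -row_mul mulmx_ker row0.
rewrite mem_lker1 mem_lker2 => /eqP/sub_kermxP/submxP[u ->].
by rewrite -mulmxA H mulmx0.
Qed.

Lemma class_rank al om :
  (\dim (fullv : {vspace 'rV[F]_n}) - \dim (lker al :&: lker om))%N =
  \rank (row_mx (hom1_cV al) (hom2_mx om)).
Proof.
rewrite (@dim_kernel _ _ _ (0 : 'cV[F]_n)); last first.
  by move=> v; rewrite memvf mulmx0 eqxx.
rewrite (@dim_kernel _ _ _ (row_mx (hom1_cV al) (hom2_mx om))).
  by rewrite mxrank0 subn0 subKn // rank_leq_row.
move=> v; rewrite memv_cap mem_lker1 mem_lker2 mul_mx_row.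
apply/andP/eqP => [[/eqP -> /eqP ->]|]; first by rewrite row_mx0.
by rewrite -row_mx0 => /eq_row_mx[-> ->]; rewrite !eqxx.
Qed.

(** The rank of [omega] is even, so the class is odd exactly when the covector
    contributes to the rank of the block matrix. *)
Lemma odd_class al om : (forall v, om v v = 0) ->
  odd (\dim (fullv : {vspace 'rV[F]_n}) - \dim (lker al :&: lker om)) =
  ~~ (lker om <= lker al)%VS.
Proof.
move=> alt; rewrite class_rank mxrank_row_mx_cV oddD.
by rewrite (negbTE (skew_rank_even (hom2_mx_skew alt))) addFb sub_lkerE oddb.
Qed.

Lemma Reeb_vector_exists al om :
  (exists v, al v = 1 /\ om v = 0) <-> ~~ (lker om <= lker al)%VS.
Proof.
split=> [[v [v1 v2]]|/subvPn[v]].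
  apply/negP => /subvP/(_ v); rewrite !memv_ker v2 eqxx v1 => /(_ isT).
  by rewrite oner_eq0.
rewrite !memv_ker => /eqP v2 v1; exists ((al v)^-1 *: v).
by rewrite !linearZ /= v2 scaler0 /GRing.scale /= mulVf.
Qed.

(** By skew-symmetry, the image of [v |-> omega v] is the annihilator of the
    kernel of [omega]. *)
Lemma Liouville_vector_exists al om : (forall v, om v v = 0) ->
  (exists v, om v = al) <-> (lker om <= lker al)%VS.
Proof.
move=> alt; have sk := hom2_mx_skew alt; split=> [[v vE]|].
  apply/subvP => w; rewrite !memv_ker -vE => /eqP w0.
  by rewrite alt_antisym // w0 lfunE oppr0.
rewrite sub_lkerE => /eqP H.
(* As [A^T = - A], the right kernel of [A], spanned by the columns of
   [cokermx A], is the transpose of its left kernel. *)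
have /submxP[D DE] : ((hom1_cV al)^T <= hom2_mx om)%MS.
  set A := hom2_mx om in sk H *.
  have /sub_kermxP/submxP[u uE] : (cokermx A)^T *m A = 0.
    by rewrite -[X in _ *m X]opprK -sk mulmxN -trmx_mul mulmx_coker trmx0 oppr0.
  rewrite submxE; apply/eqP/trmx_inj.
  by rewrite trmx_mul trmxK uE -mulmxA H mulmx0 trmx0.
exists D; apply/lfunP => w; rewrite hom2E hom1E -DE.
by rewrite -[in LHS]trmx_mul mxE.
Qed.

End Pointwise.

(** * Charts and transition maps *)

Section ChartTopology.
Context (R : realType) (n : nat) (T : topologicalType) (c : chart R n T).

Lemma chart_inv_dom y : chart_img c y -> chart_dom c (chart_inv c y).
Proof. by case=> x cx <-; rewrite chart_mapK ?inE. Qed.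

Lemma chart_invK y : chart_img c y -> c (chart_inv c y) = y.
Proof. by case=> x cx <-; rewrite chart_mapK ?inE. Qed.

Lemma chart_image_domI (O : set T) :
  c @` (chart_dom c `&` O) = chart_img c `&` (chart_inv c @^-1` O).
Proof.
apply/seteqP; split=> y.
  by move=> [x [cx Ox] <-]; split; [exists x|rewrite /= chart_mapK ?inE].
move=> [iy Oy]; exists (chart_inv c y); last exact: chart_invK.
by split=> //; exact: chart_inv_dom.
Qed.

Lemma chart_image_open (O : set T) : open O -> open (c @` (chart_dom c `&` O)).
Proof.
move=> oO; rewrite chart_image_domI openE => y [iy Oy].
apply: filterI; first exact: (open_nbhs_nbhs (conj (@chart_img_open _ _ _ c) iy)).
have iy' : y \in c @` chart_dom c by rewrite inE.
by apply: (chart_inv_continuous iy'); exact: open_nbhs_nbhs.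
Qed.

Lemma chart_preimage_open (N : set 'rV[R]_n) : open N ->
  open (chart_dom c `&` c @^-1` N).
Proof.
move=> oN; rewrite openE => x [cx Nx].
apply: filterI; first exact: (open_nbhs_nbhs (conj (@chart_dom_open _ _ _ c) cx)).
have cx' : x \in chart_dom c by rewrite inE.
by apply: (chart_map_continuous cx'); exact: open_nbhs_nbhs.
Qed.

End ChartTopology.

Section Transition.
Context (R : realType) (n : nat) (M : manifold R n).
Implicit Types (a b c : chart R n M) (x : M).

Lemma chart_at_atlas x : atlas (chart_at x).
Proof. by rewrite /chart_at; case: cid2. Qed.

Lemma chart_at_dom x : chart_dom (chart_at x) x.
Proof. by rewrite /chart_at; case: cid2. Qed.

Lemma transition_differentiable a b x : atlas a -> atlas b ->
  chart_dom a x -> chart_dom b x -> differentiable (b \o chart_inv a) (a x).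
Proof.
move=> Aa Ab ax bx; have [H _] := atlas_smooth Aa Ab 1%N.
by apply: H; exists x.
Qed.

(** The cocycle rule for transition maps, which makes the passage between the
    components of a tangent vector in different charts consistent. *)
Lemma diff_transition_comp a b c x v : atlas a -> atlas b -> atlas c ->
  chart_dom a x -> chart_dom b x -> chart_dom c x ->
  'd (c \o chart_inv b) (b x) ('d (b \o chart_inv a) (a x) v) =
  'd (c \o chart_inv a) (a x) v.
Proof.
move=> Aa Ab Ac ax bx cx.
have dab := transition_differentiable Aa Ab ax bx.
have dbc := transition_differentiable Ab Ac bx cx.
have bE : (b \o chart_inv a) (a x) = b x by rewrite /= chart_mapK ?inE.
have dbc' : differentiable (c \o chart_inv b) ((b \o chart_inv a) (a x)).
  by rewrite bE.
have E : 'd (c \o chart_inv a) (a x) =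
    'd ((c \o chart_inv b) \o (b \o chart_inv a)) (a x) :> ('rV[R]_n -> 'rV[R]_n).
  apply: near_eq_diff; last exact: differentiable_comp.
  have oab := @chart_image_open _ _ _ a _ (@chart_dom_open _ _ _ b).
  have axab : (a @` (chart_dom a `&` chart_dom b)) (a x) by exists x.
  apply: filterS (open_nbhs_nbhs (conj oab axab)) => _ [z [az bz] <-].
  by rewrite /= !chart_mapK ?inE.
have Ec := diff_comp dab dbc'; rewrite bE in Ec.
exact: esym (etrans (congr1 (fun f : 'rV[R]_n -> 'rV[R]_n => f v) E)
  (congr1 (fun f : 'rV[R]_n -> 'rV[R]_n => f v) Ec)).
Qed.

Lemma diff_transition_id a x v : atlas a -> chart_dom a x ->
  'd (a \o chart_inv a) (a x) v = v.
Proof.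
move=> Aa ax.
have E : 'd (a \o chart_inv a) (a x) = 'd (@id 'rV[R]_n) (a x)
    :> ('rV[R]_n -> 'rV[R]_n).
  apply: near_eq_diff; last exact: ex_diff.
  have iax : chart_img a (a x) by exists x.
  apply: filterS (open_nbhs_nbhs (conj (@chart_img_open _ _ _ a) iax)) => y iy.
  by rewrite /= chart_invK.
have Ei : 'd (@id 'rV[R]_n) (a x) = id :> ('rV[R]_n -> 'rV[R]_n).
  exact: diff_val.
exact: etrans (congr1 (fun f : 'rV[R]_n -> 'rV[R]_n => f v) E)
  (congr1 (fun f : 'rV[R]_n -> 'rV[R]_n => f v) Ei).
Qed.

Lemma of_chartK c x (w : 'rV[R]_n) : atlas c -> chart_dom c x ->
  to_chart c (of_chart c x w) = w.
Proof.
move=> Ac cx; rewrite /to_chart /of_chart diff_transition_comp ?diff_transition_id //.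
- exact: chart_at_atlas.
- exact: chart_at_dom.
Qed.

Lemma to_chart_of_chart c d x (w : 'rV[R]_n) : atlas c -> atlas d ->
  chart_dom c x -> chart_dom d x ->
  to_chart d (of_chart c x w) = 'd (d \o chart_inv c) (c x) w.
Proof.
have Ax := chart_at_atlas x; have dx := chart_at_dom x.
by move=> Ac Ad cx dx'; apply: diff_transition_comp.
Qed.

End Transition.

(** * Smooth fields on a manifold and gluing *)

Section SmoothOnManifold.
Context (R : realType) (n : nat) (M : manifold R n).
Implicit Types (G : set M) (h : M -> R) (X Y : forall x : M, tangent x).

Definition fsmooth_on G h := forall c : chart R n M, atlas c ->
  smooth_on (W := R^o) (c @` (chart_dom c `&` G)) (fun y => h (chart_inv c y)).

Definition vsmooth_on G X := forall c : chart R n M, atlas c ->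
  smooth_on (c @` (chart_dom c `&` G)) (fun y => to_chart c (X (chart_inv c y))).

Lemma fsmooth_on_ext G h h' : open G -> (forall x, G x -> h x = h' x) ->
  fsmooth_on G h -> fsmooth_on G h'.
Proof.
move=> oO hh' sh c Ac k; apply: Ck_ext (sh c Ac k).
  exact: chart_image_open.
by move=> _ [x [cx Ox] <-]; rewrite chart_mapK ?inE // hh'.
Qed.

Lemma vsmooth_on_ext G X Y : open G -> (forall x, G x -> X x = Y x) ->
  vsmooth_on G X -> vsmooth_on G Y.
Proof.
move=> oO XY sX c Ac k; apply: Ck_ext (sX c Ac k).
  exact: chart_image_open.
by move=> _ [x [cx Ox] <-]; rewrite chart_mapK ?inE // XY.
Qed.

Lemma fsmooth_on_local G h :
  (forall x, G x -> exists2 G', G' x & fsmooth_on G' h) -> fsmooth_on G h.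
Proof.
move=> H c Ac k; apply: Ck_local => _ [x [cx Ox] <-].
have [G' G'x sh] := H x Ox.
exists (c @` (chart_dom c `&` G')); last exact: sh.
by exists x.
Qed.

Lemma vsmooth_on_local G X :
  (forall x, G x -> exists2 G', G' x & vsmooth_on G' X) -> vsmooth_on G X.
Proof.
move=> H c Ac k; apply: Ck_local => _ [x [cx Ox] <-].
have [G' G'x sX] := H x Ox; exists (c @` (chart_dom c `&` G')); last exact: sX.
by exists x.
Qed.

Lemma fsmooth_on_subset G G' h : G' `<=` G -> fsmooth_on G h -> fsmooth_on G' h.
Proof.
move=> GG' sh; apply: fsmooth_on_local => x G'x; exists G => //; exact: GG'.
Qed.

Lemma vsmooth_on_subset G G' X : G' `<=` G -> vsmooth_on G X -> vsmooth_on G' X.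
Proof.
move=> GG' sX; apply: vsmooth_on_local => x G'x; exists G => //; exact: GG'.
Qed.

Lemma fsmooth_cst G (a : R) : open G -> fsmooth_on G (fun=> a).
Proof. by move=> oO c Ac k; apply: Ck_cst; exact: chart_image_open. Qed.

Lemma fsmoothB G h h' : open G -> fsmooth_on G h -> fsmooth_on G h' ->
  fsmooth_on G (fun x => h x - h' x).
Proof.
move=> oO sh sh' c Ac k; have oc := @chart_image_open _ _ _ c _ oO.
exact: CkD oc (sh c Ac k) (CkN oc (sh' c Ac k)).
Qed.

Lemma fsmoothM G h h' : open G -> fsmooth_on G h -> fsmooth_on G h' ->
  fsmooth_on G (fun x => h x * h' x).
Proof.
move=> oO sh sh' c Ac k; have oc := @chart_image_open _ _ _ c _ oO.
exact: CkM oc (sh c Ac k) (sh' c Ac k).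
Qed.

Lemma vsmooth0 G : open G -> vsmooth_on G (fun=> 0 : 'rV[R]_n).
Proof.
move=> oO c Ac k; have oc := @chart_image_open _ _ _ c _ oO.
by apply: Ck_ext (Ck_cst k 0 oc) => // y _; rewrite /to_chart linear0.
Qed.

Lemma vsmoothD G X Y : open G -> vsmooth_on G X -> vsmooth_on G Y ->
  vsmooth_on G (fun x => (X x : 'rV[R]_n) + Y x).
Proof.
move=> oO sX sY c Ac k; have oc := @chart_image_open _ _ _ c _ oO.
apply: Ck_ext (CkD oc (sX c Ac k) (sY c Ac k)) => // y _.
by rewrite /to_chart linearD.
Qed.

Lemma vsmoothZ G h X : open G -> fsmooth_on G h -> vsmooth_on G X ->
  vsmooth_on G (fun x => h x *: (X x : 'rV[R]_n)).
Proof.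
move=> oO sh sX c Ac k; have oc := @chart_image_open _ _ _ c _ oO.
apply: Ck_ext (CkZ oc (sh c Ac k) (sX c Ac k)) => // y _.
by rewrite /to_chart linearZ.
Qed.

(** A bump function in a chart around [x0] extends by zero to the whole manifold
    because its support there is compact, hence closed in [M]: this is where
    the Hausdorff property enters. *)
Lemma manifold_bump G x0 : open G -> G x0 -> exists h K B,
  [/\ fsmooth_on setT h, closed K /\ K `<=` G, forall x, ~ K x -> h x = 0,
      open B /\ B x0 & forall x, B x -> h x = 1].
Proof.
move=> oO Ox0; pose c := chart_at x0.
have Ac : atlas c := chart_at_atlas x0.
have cx0 : chart_dom c x0 := chart_at_dom x0.
have Nc : nbhs (c x0) (c @` (chart_dom c `&` G)).
  by apply: open_nbhs_nbhs; split; [exact: chart_image_open|exists x0].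
have [g [Z [sg cZ ZN g0 g1]]] := bump_exists Nc.
pose K := chart_inv c @` Z.
have Zimg : Z `<=` chart_img c.
  by move=> y /ZN [x [cx _] <-]; exists x.
have cK : closed K.
  apply: compact_closed; first exact: manifold_hausdorff.
  apply: continuous_compact cZ; apply: continuous_in_subspaceT => y.
  rewrite inE => /Zimg iy; apply: chart_inv_continuous; by rewrite inE.
pose h x := if x \in chart_dom c then g (c x) else 0.
have h0 x : ~ K x -> h x = 0.
  rewrite /h; case: ifPn => // /[!inE] cx Kx; apply: g0 => Zcx; apply: Kx.
  by exists (c x) => //; rewrite chart_mapK ?inE.
exists h, K, (chart_dom c `&` c @^-1` (interior [set y | g y = 1])); split => //.
- apply: fsmooth_on_local => x _; have [cx|cx] := pselect (chart_dom c x).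
    exists (chart_dom c) => // d Ad k.
    have od := @chart_image_open _ _ _ d _ (@chart_dom_open _ _ _ c).
    have := Ck_comp od openT (fun _ _ => I) (atlas_smooth Ad Ac k) (sg k).
    apply: Ck_ext => // _ [z [dz cz] <-] /=.
    by rewrite chart_mapK ?inE // /h mem_set.
  exists (~` K).
    move=> [y Zy yx]; apply: cx; rewrite -yx; apply: chart_inv_dom; exact: Zimg.
  apply: fsmooth_on_ext (fsmooth_cst 0 _); rewrite ?openC //.
  - by move=> y /h0.
- split => // _ [y /ZN [x [cx Ox] <-] <-]; by rewrite chart_mapK ?inE.
- split; last by split.
  by apply: chart_preimage_open; exact: open_interior.
- by move=> x [cx /interior_subset gx]; rewrite /h mem_set.
Qed.

End SmoothOnManifold.

Section Gluing.
Context (R : realType) (n : nat) (M : manifold R n).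
(* For a linear system, [P x s v] says that [v] solves it at [x] with its
   right-hand side multiplied by [s].  Keeping track of [s] allows solutions to
   be weighted and added before the weights sum to one. *)
Variable (P : M -> R -> 'rV[R]_n -> Prop).
Hypothesis P0 : forall x, P x 0 0.
Hypothesis PD : forall x s t v w, P x s v -> P x t w ->
  P x (s + t) (v + w).
Hypothesis PZ : forall x r s v, P x s v ->
  P x (r * s) (r *: v).
Hypothesis P_local : forall x0 : M, exists G (X : forall x : M, tangent x),
  [/\ open G, G x0, vsmooth_on G X & forall x, G x -> P x 1 (X x)].

Let datum := (set M * (M -> R) * (forall x : M, tangent x))%type.
Let good (D : datum) := let: (B, h, X) := D in
  [/\ open B, forall x, B x -> h x = 1, fsmooth_on setT h,
      vsmooth_on setT X & forall x, P x (h x) (X x)].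

Let good_ex x0 : exists2 D : datum, good D & D.1.1 x0.
Proof.
have [G [X [oO Ox0 sX PX]]] := P_local x0.
have [h [K [B [sh [cK KO] h0 [oB Bx0] h1]]]] := manifold_bump oO Ox0.
exists (B, h, fun x => h x *: (X x : 'rV[R]_n)) => //=; split => //.
  apply: vsmooth_on_local => x _; have [Ox|Ox] := pselect (G x).
    exists G => //; apply: vsmoothZ => //.
    exact: fsmooth_on_subset sh.
  exists (~` K); first by move=> /KO.
  apply: vsmooth_on_ext (vsmooth0 _); rewrite ?openC //.
  by move=> y /h0 ->; rewrite scale0r.
move=> x; have [Ox|Ox] := pselect (G x).
  by have := PZ (h x) (PX x Ox); rewrite mulr1.
by rewrite h0 ?scale0r; [exact: P0|move=> /KO].
Qed.

Let good_trivial : good (set0, fun=> 0, fun=> 0 : 'rV[R]_n).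
Proof.
split; [exact: open0|by []|exact: (fsmooth_cst _ openT)|exact: vsmooth0 openT|].
by move=> x; exact: P0.
Qed.

(** Countably many data suffice, by the Lindelof argument: for each basic open
    set contained in the open set of some datum, one such datum is chosen. *)
Let good_seq : exists D : nat -> datum,
  (forall k, good (D k)) /\ forall x, exists k, (D k).1.1 x.
Proof.
have [BB /countable_injP[f f_inj] [BBo BBnbhs]] := @manifold_second_countable _ _ M.
have H k : exists D : datum, good D /\
    forall U, BB U -> f U = k -> (exists2 D', good D' & U `<=` D'.1.1) ->
      U `<=` D.1.1.
  have [[U [BU fU [D' gD' UD']]]|Hno] := pselect (exists U, [/\ BB U, f U = k &
      exists2 D', good D' & U `<=` D'.1.1]).
    exists D'; split=> // U' BU' fU' _.
    by rewrite (f_inj U' U) ?inE // fU fU'.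
  exists (set0, fun=> 0, fun=> 0 : 'rV[R]_n); split; first exact: good_trivial.
  by move=> U BU fU HU; exfalso; apply: Hno; exists U.
have [D HD] := choice H; exists D; split=> [k|x]; first by have [] := HD k.
have [D' gD' D'x] := good_ex x.
have oB : open D'.1.1 by case: D' gD' {D'x} => [[B h] X] [].
have [U [BU Ux] UB] := BBnbhs x _ (open_nbhs_nbhs (conj oB D'x)).
exists (f U); have [_ /(_ U BU erefl)] := HD (f U); apply => //.
by exists D'.
Qed.

(** With [Q k] the product of the [1 - h j] for [j < k], the partial sum
    [S k] of the averaged solutions solves the system up to the factor
    [1 - Q k].  Near a point of [B j] the sums are stationary after rank [j],
    because [Q] vanishes there, and their common value is the solution. *)
Theorem glue_local_solutions : exists V : vector_field M, forall x, P x 1 (V x).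
Proof.
have [D [gD covD]] := good_seq.
pose B k := (D k).1.1; pose h k := (D k).1.2; pose X k := (D k).2.
have [oB h1 sh sX PX] : [/\ forall k, open (B k), forall k x, B k x -> h k x = 1,
   forall k, fsmooth_on setT (h k), forall k, vsmooth_on setT (X k) &
   forall k x, P x (h k x) (X k x)].
  by split=> k; have := gD k; rewrite /B /h /X; case: (D k) => [[? ?] ?] [].
pose Q := fix Q k (x : M) : R := if k is k'.+1 then Q k' x * (1 - h k' x) else 1.
pose S := fix S k (x : M) : 'rV[R]_n :=
  if k is k'.+1 then S k' x + Q k' x *: (X k' x : 'rV[R]_n) else 0.
have sQ k : fsmooth_on setT (Q k).
  elim: k => [|k IH] /=; first exact: (fsmooth_cst _ openT).
  apply: fsmoothM openT IH _; apply: fsmoothB openT _ (sh k).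
  exact: (fsmooth_cst _ openT).
have sS k : vsmooth_on setT (S k).
  elim: k => [|k IH] /=; first exact: vsmooth0 openT.
  by apply: (vsmoothD openT IH); exact: vsmoothZ openT (sQ k) (sX k).
have PS k x : P x (1 - Q k x) (S k x).
  elim: k => [|k IH] /=; first by rewrite subrr; exact: P0.
  have -> : 1 - Q k x * (1 - h k x) = (1 - Q k x) + Q k x * h k x.
    by rewrite mulrBr mulr1 opprB addrA addrAC.
  by apply: PD IH _; exact: PZ.
have Q0 j k x : B j x -> (j < k)%N -> Q k x = 0.
  move=> Bx; elim: k => // k IH; rewrite ltnS leq_eqVlt => /predU1P[<-|/IH Qk] /=.
    by rewrite h1 // subrr mulr0.
  by rewrite Qk mul0r.
have SE j k x : B j x -> (j < k)%N -> S k x = S j.+1 x.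
  move=> Bx; elim: k => // k IH; rewrite ltnS leq_eqVlt => /predU1P[<-//|jk].
  by rewrite -(IH jk) [LHS]/= (Q0 j) // scale0r addr0.
have [K HK] := choice covD.
(* The index [K x] depends on [x] arbitrarily; by [VE], the value of [V] does
   not depend on this choice. *)
pose V x : tangent x := S (K x).+1 x.
have VE j x : B j x -> V x = S j.+1 x.
  move=> Bx; rewrite /V -(SE _ (maxn (K x) j).+1 _ (HK x)) ?ltnS ?leq_maxl //.
  by apply: SE; rewrite ?ltnS ?leq_maxr.
have sV : vsmooth_on setT V.
  apply: vsmooth_on_local => x _; have [j Bx] := covD x; exists (B j) => //.
  apply: vsmooth_on_ext (oB j) _ (vsmooth_on_subset _ (sS j.+1)) => //.
  by move=> y /VE.
have sV' c : atlas c ->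
    smooth_on (chart_img c) (fun y => to_chart c (V (chart_inv c y))).
  by move=> /sV; rewrite setIT.
exists (VectorField sV') => x /=.
have := PS (K x).+1 x; rewrite (Q0 (K x)) // ?subr0 //; exact: HK.
Qed.

End Gluing.

(** * Smooth solutions of linear systems of constant rank *)

Section SmoothMatrices.
Context (R : realType) (n : nat) (U : set 'rV[R]_n).
Hypothesis oU : open U.

Definition mx_smooth p q (F : 'rV[R]_n -> 'M[R]_(p, q)) :=
  forall i j, smooth_on (W := R^o) U (fun y => F y i j).

Lemma mx_smooth_cst p q (A : 'M[R]_(p, q)) : mx_smooth (fun=> A).
Proof. by move=> i j k; apply: Ck_cst. Qed.

Lemma mx_smoothM p q r (F : 'rV[R]_n -> 'M[R]_(p, q)) (G : 'rV[R]_n -> 'M[R]_(q, r)) :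
  mx_smooth F -> mx_smooth G -> mx_smooth (fun y => F y *m G y).
Proof.
move=> sF sG i j k.
have : Ck (W := R^o) k U (fun y => \sum_l F y i l * G y l j).
  by apply: Ck_sum => // l _; apply: CkM => //; [exact: sF|exact: sG].
by apply: Ck_ext => // y _; rewrite mxE.
Qed.

Lemma mx_smooth_det p (F : 'rV[R]_n -> 'M[R]_p) :
  mx_smooth F -> smooth_on (W := R^o) U (fun y => \det (F y)).
Proof.
move=> sF k; apply: Ck_sum => // s _; apply: CkM => //; first exact: Ck_cst.
by apply: Ck_prod => // i _; exact: sF.
Qed.

Lemma mx_smooth_adj p (F : 'rV[R]_n -> 'M[R]_p) :
  mx_smooth F -> mx_smooth (fun y => \adj (F y)).
Proof.
move=> sF i j k.
have : Ck (W := R^o) k U (fun y => (-1) ^+ (j + i) * \det (row' j (col' i (F y)))).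
  apply: CkM => //; first exact: Ck_cst.
  apply: mx_smooth_det => i' j' k'.
  by apply: Ck_ext (sF (lift j i') (lift i j') k') => // y _; rewrite !mxE.
by apply: Ck_ext => // y _; rewrite mxE.
Qed.

End SmoothMatrices.

Lemma mx_smooth_subset (R : realType) (n p q : nat) (U U' : set 'rV[R]_n)
    (F : 'rV[R]_n -> 'M[R]_(p, q)) :
  U' `<=` U -> mx_smooth U F -> mx_smooth U' F.
Proof. by move=> UU' sF i j k; apply: Ck_subset (sF i j k). Qed.

(** Where the minor chosen at [y0] stays invertible, the constancy of the rank
    makes it a minor of maximal size, so that Cramer's rule applies and gives a
    solution that is rational in the coefficients. *)
Lemma smooth_linear_solve (R : realType) (n p m : nat) (U : set 'rV[R]_n)
    (B : 'rV[R]_n -> 'M[R]_(p, m)) (b : 'rV[R]_n -> 'rV[R]_m) (y0 : 'rV[R]_n) :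
  open U -> U y0 -> mx_smooth U B -> mx_smooth U b ->
  (forall y, U y -> \rank (B y) = \rank (B y0)) ->
  (forall y, U y -> (b y <= B y)%MS) ->
  exists N (w : 'rV[R]_n -> 'rV[R]_p),
    [/\ open N, N y0, N `<=` U, smooth_on N w & forall y, N y -> w y *m B y = b y].
Proof.
move=> oU Uy0 sB sb rB bB; have [C [D CD]] := invertible_minor (B y0).
pose S y := C *m B y *m D.
have sS : mx_smooth U S.
  by apply: mx_smoothM => //; [apply: mx_smoothM => //|]; exact: mx_smooth_cst.
have sd := mx_smooth_det oU sS.
pose N := [set y | U y /\ \det (S y) != 0].
have NU : N `<=` U by move=> y [].
have oN : open N.
  rewrite openE => y [Uy Sy]; apply: filterI.
    exact: open_nbhs_nbhs (conj oU Uy).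
  have Uy' : y \in U by rewrite inE.
  apply: (sd 0 y Uy' [set t : R | t != 0]); apply: open_nbhs_nbhs.
  split; last exact: Sy.
  exact: (@open_neq R 0).
have Ny0 : N y0 by split => //; rewrite /S CD det1 oner_eq0.
pose w y := (\det (S y))^-1 *: (b y *m D *m \adj (S y) *m C).
exists N, w; split => //.
  move=> k; apply: CkZ => //.
    by apply: CkV => // [y []//|]; exact: Ck_subset (sd k).
  apply/(Ck_coordP _ _ oN) => j.
  have H : mx_smooth N (fun y => b y *m D *m \adj (S y) *m C).
    apply: mx_smoothM => //; last exact: mx_smooth_cst.
    apply: mx_smoothM => //; last by apply: mx_smooth_subset (mx_smooth_adj oU sS).
    apply: mx_smoothM => //; last exact: mx_smooth_cst.
    exact: mx_smooth_subset sb.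
  exact: H.
move=> y [Uy Sy].
have uS : S y \in unitmx by rewrite unitmxE unitfE.
rewrite /w -!scalemxAl -[RHS](solve_by_minor (rB y Uy) uS (bB y Uy)).
by rewrite -/(S y) /invmx uS -!(scalemxAr, scalemxAl).
Qed.

Section SmoothSolution.
Context (R : realType) (n m : nat) (M : manifold R n).

Definition of_chart_mx (c : chart R n M) (x : M) : 'M[R]_n :=
  jacobian (chart_at x \o chart_inv c) (c x).

Lemma of_chart_mxE c x w : of_chart c x w = w *m of_chart_mx c x.
Proof. by rewrite /of_chart_mx /jacobian mul_rV_lin1. Qed.

Lemma of_chart_mx_unit c x : atlas c -> chart_dom c x -> of_chart_mx c x \in unitmx.
Proof.
move=> Ac cx; rewrite -row_free_unit; apply: inj_row_free => v.
rewrite -of_chart_mxE => v0; rewrite -(of_chartK v Ac cx) v0.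
exact: linear0.
Qed.

(** The entries of [B x] and [b x] refer to the components of tangent vectors in
    [chart_at x], which varies arbitrarily with [x], so they are not smooth by
    themselves.  Smoothness is required after the rows are expressed in a fixed
    chart [c] by [of_chart_mx c x] and the columns are transformed by [Q c x],
    which accounts for equations that are themselves indexed by components. *)
Theorem smooth_solution (B : M -> 'M[R]_(n, m)) (b : M -> 'rV[R]_m)
    (Q : chart R n M -> M -> 'M[R]_m) :
  (forall c x, atlas c -> chart_dom c x -> Q c x \in unitmx) ->
  (forall c, atlas c -> mx_smooth (chart_img c) (fun y => let x := chart_inv c y in
     of_chart_mx c x *m B x *m Q c x)) ->
  (forall c, atlas c -> mx_smooth (chart_img c) (fun y => let x := chart_inv c y in
     b x *m Q c x)) ->
  (forall x x', \rank (B x) = \rank (B x')) ->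
  (forall x, (b x <= B x)%MS) ->
  exists V : vector_field M, forall x, (V x : 'rV[R]_n) *m B x = b x.
Proof.
move=> uQ sB sb rB bB.
have [|x s t v w vs wt|x r s v vs|x0|V HV] :=
  @glue_local_solutions R n M (fun x s v => v *m B x = s *: b x).
- by move=> x; rewrite mul0mx scale0r.
- by rewrite mulmxDl vs wt scalerDl.
- by rewrite -scalemxAl vs scalerA.
- pose c := chart_at x0.
  have Ac : atlas c := chart_at_atlas x0.
  have cx0 : chart_dom c x0 := chart_at_dom x0.
  have ic : chart_img c (c x0) by exists x0.
  have ru y : chart_img c y -> let x := chart_inv c y in
      \rank (of_chart_mx c x *m B x *m Q c x) = \rank (B x).
    move=> iy /=; have cy := chart_inv_dom iy.
    rewrite mxrankMfree ?row_free_unit ?uQ //.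
    by rewrite eqmxMfull // row_full_unit of_chart_mx_unit.
  have [|y iy|N [w [oN Ny0 NU sw wE]]] := smooth_linear_solve
    (@chart_img_open _ _ _ c) ic (sB c Ac) (sb c Ac) _ _.
  + by move=> y iy; rewrite !ru //; exact: rB.
  + have cy := chart_inv_dom iy; have uJ := of_chart_mx_unit Ac cy.
    apply: submxMr; apply: submx_trans (bB _) _.
    by rewrite -[X in (X <= _)%MS](mulKmx uJ); exact: submxMl.
  exists (chart_dom c `&` c @^-1` N), (fun x => of_chart c x (w (c x))); split => //.
  + exact: chart_preimage_open.
  + move=> d Ad k.
    have oN' := chart_preimage_open c oN.
    have od := @chart_image_open _ _ _ d _ oN'.
    (* The field has components [D f(u)(w u)] in [d], at the point [u] that
       represents the base point in [c]. *)
    pose f := d \o chart_inv c; pose g := c \o chart_inv d.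
    pose T := c @` (chart_dom c `&` chart_dom d) `&` N.
    have oT : open T.
      apply: openI => //; apply: chart_image_open; exact: chart_dom_open.
    have sf : smooth_on T f.
      by move=> k'; apply: Ck_subset (atlas_smooth Ac Ad k') => y [].
    have df u : T u -> differentiable f u by have [H _] := sf 1%N; exact: H.
    pose phi u := \sum_i w u 0 i *: 'D_(delta_mx 0 i) f u.
    have sphi : Ck k T phi.
      apply: Ck_sum => // i _; apply: CkZ => //.
        apply: Ck_subset (_ : Ck k N _); first by move=> y [].
        by move: (sw k) => /(Ck_coordP _ _ oN).
      by have [_ H] := sf k.+1; exact: H.
    have : Ck k (d @` (chart_dom d `&` (chart_dom c `&` c @^-1` N))) (phi \o g).
      apply/(Ck_coordP _ _ od) => j.
      apply: (Ck_comp (V := T) od oT (g := g) (f := fun u => phi u 0 j)).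
      - move=> _ [z [dz [cz Nz]] <-]; rewrite /g /= chart_mapK ?inE //.
        by split => //; exists z.
      - apply: Ck_subset (atlas_smooth Ad Ac k).
        by move=> _ [z [dz [cz Nz]] <-]; exists z.
      - by move: sphi => /(Ck_coordP _ _ oT).
    apply: Ck_ext => // _ [z [dz [cz Nz]] <-] /=.
    rewrite /g /= chart_mapK ?inE // to_chart_of_chart // -/f.
    have Tz : T (c z) by split => //; exists z.
    rewrite [in RHS](row_sum_delta (w (c z))) linear_sum /phi.
    by apply: eq_bigr => i _; rewrite linearZ /= (deriveE _ (df _ Tz)).
  + move=> x [cx Nx]; rewrite scale1r of_chart_mxE.
    have := wE _ Nx; rewrite /= chart_mapK ?inE // !mulmxA.
    by move=> /(can_inj (mulmxK (uQ _ _ Ac cx))).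
by exists V => x; rewrite HV scale1r.
Qed.

End SmoothSolution.

(** * Reeb and Liouville fields *)

Section Fields.
Context (R : realType) (n : nat) (M : manifold R n).
Variables (tau : form1 M) (omega : form2 M).

Let t x : 'cV[R]_n := hom1_cV (tau x).
Let A x : 'M[R]_n := hom2_mx (omega x).
Let J := @of_chart_mx R n M.

Lemma pair_class_rank x : pair_class tau omega x = \rank (row_mx (t x) (A x)).
Proof. exact: class_rank. Qed.

Lemma odd_pair_class x :
  odd (pair_class tau omega x) = ~~ (lker (omega x) <= lker (tau x))%VS.
Proof. by apply: odd_class; exact: form2_alt. Qed.

Let tJ c x i : (J c x *m t x) i 0 = tau x (of_chart c x (delta_mx 0 i)).
Proof. by rewrite of_chart_mxE hom1E -mulmxA -rowE [RHS]mxE. Qed.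

Let AJ c x i j : (J c x *m A x *m (J c x)^T) i j =
  omega x (of_chart c x (delta_mx 0 i)) (of_chart c x (delta_mx 0 j)).
Proof.
rewrite !of_chart_mxE hom2E trmx_mul trmx_delta.
by rewrite -!mulmxA -rowE !mulmxA -colE !mxE.
Qed.

Let smooth_tJ c : atlas c -> mx_smooth (chart_img c)
  (fun y => let x := chart_inv c y in J c x *m t x).
Proof.
move=> Ac i j k; rewrite ord1; have := form1_smooth tau Ac (delta_mx 0 i) k.
apply: Ck_ext; first exact: chart_img_open.
by move=> y _; rewrite tJ.
Qed.

Let smooth_AJ c : atlas c -> mx_smooth (chart_img c)
  (fun y => let x := chart_inv c y in J c x *m A x *m (J c x)^T).
Proof.
move=> Ac i j k; have := form2_smooth omega Ac (delta_mx 0 i) (delta_mx 0 j) k.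
apply: Ck_ext; first exact: chart_img_open.
by move=> y _; rewrite AJ.
Qed.

(** When [Ker omega] is contained in [Ker tau] the class is the rank of [omega],
    which is therefore constant.  The transposed change of basis acts on the
    equations, since these are indexed by the second argument of [omega]. *)
Lemma Liouville_field_exists k : doublet tau omega k ->
  (forall x, (lker (omega x) <= lker (tau x))%VS) ->
  exists V : vector_field M, Liouville_field tau omega V.
Proof.
move=> dk sub.
have kt x : kermx (A x) *m t x == 0 by have := sub x; rewrite sub_lkerE.
have [c x Ac cx|c Ac|c Ac i j k'|x x'|x|V HV] :=
  @smooth_solution R n n M A (fun x => (t x)^T) (fun c x => (J c x)^T).
- by rewrite unitmx_tr of_chart_mx_unit.
- exact: smooth_AJ.
- apply: Ck_ext (smooth_tJ Ac j i k'); first exact: chart_img_open.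
  by move=> y _ /=; rewrite -trmx_mul [RHS]mxE.
- have rk z : \rank (A z) = k.
    by rewrite -(dk z) pair_class_rank mxrank_row_mx_cV kt addn0.
  by rewrite !rk.
- have alt := @form2_alt _ _ _ omega x.
  have [_ /(_ (sub x)) [v vE]] := Liouville_vector_exists (tau x) alt.
  apply/submxP; exists v; apply/rowP => j; rewrite hom2_rVE mxE [RHS]mxE vE.
  by rewrite mxE.
exists V => x; apply/lfunP => w.
by rewrite hom2E HV hom1E -trmx_mul mxE.
Qed.

(** The coefficient matrix of the Reeb equations is the block matrix whose rank
    is the class; the equation [tau v = 1] is independent of the chart and the
    remaining ones transform as for Liouville fields. *)
Lemma Reeb_field_exists k : doublet tau omega k ->
  (forall x, ~~ (lker (omega x) <= lker (tau x))%VS) ->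
  exists V : vector_field M, Reeb_field tau omega V.
Proof.
move=> dk nsub.
have [c x Ac cx|c Ac|c Ac|x x'|x|V HV] :=
  @smooth_solution R n (1 + n) M (fun x => row_mx (t x) (A x))
    (fun x => row_mx 1%:M 0) (fun c x => block_mx 1%:M 0 0 (J c x)^T).
- by rewrite unitmxE det_ublock det1 mul1r -unitmxE unitmx_tr of_chart_mx_unit.
- move=> i j k'.
  have [j' jE|j' jE] := split_ordP j.
    apply: Ck_ext (smooth_tJ Ac i j' k'); first exact: chart_img_open.
    move=> y _; rewrite jE /= mul_mx_row mul_row_block !mulmx0 addr0 add0r mulmx1.
    by rewrite row_mxEl.
  apply: Ck_ext (smooth_AJ Ac i j' k'); first exact: chart_img_open.
  move=> y _; rewrite jE /= mul_mx_row mul_row_block !mulmx0 addr0 add0r mulmx1.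
  by rewrite row_mxEr.
- have oc := @chart_img_open _ _ _ c; move=> i j k'.
  apply: Ck_ext (mx_smooth_cst oc (row_mx 1%:M 0 : 'rV[R]_(1 + n)) i j k') => //.
  by move=> y _; rewrite /= mul_row_block !mulmx0 !mul0mx mulmx1 !addr0.
- by have := dk x; have := dk x'; rewrite !pair_class_rank => -> ->.
- have [_ /(_ (nsub x)) [v [v1 v2]]] := Reeb_vector_exists (tau x) (omega x).
  apply/submxP; exists v; rewrite mul_mx_row; congr row_mx.
    by apply/matrixP => i j; rewrite !ord1 -hom1E v1 mxE.
  by rewrite hom2_rVE v2; apply/rowP => j; rewrite !mxE lfunE.
exists V => x; have := HV x; rewrite mul_mx_row => /eq_row_mx[H1 H2]; split.
  by rewrite hom1E H1 mxE.
by apply/lfunP => w; rewrite hom2E H2 mul0mx mxE lfunE.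
Qed.

Lemma Ker_subE : (Ker2 omega `<=` Ker1 tau) <->
  forall x, (lker (omega x) <= lker (tau x))%VS.
Proof.
split=> [H x|H [x v] /= vK].
  by apply/subvP => v vK; exact: (H (existT _ x v)).
by have /subvP := H x; apply.
Qed.

End Fields.

Theorem theorem2p13 (R : realType) (n : nat) (M : manifold R n)
    (M0 : [set: M] !=set0) (tau : form1 M) (omega : form2 M) :
  (forall k : nat, doublet tau omega k ->
     [<-> odd k;
          ~ (Ker2 omega `<=` Ker1 tau);
          exists V : vector_field M, Reeb_field tau omega V] /\
     [<-> ~~ odd k;
          Ker2 omega `<=` Ker1 tau;
          exists V : vector_field M, Liouville_field tau omega V]) /\
  (forall x : M,
     [<-> odd (pair_class tau omega x);
          ~ (lker (omega x) <= lker (tau x))%VS;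
          exists v : tangent x, Reeb_vector tau omega v] /\
     [<-> ~~ odd (pair_class tau omega x);
          (lker (omega x) <= lker (tau x))%VS;
          exists v : tangent x, Liouville_vector tau omega v]).
Proof.
have alt x := @form2_alt _ _ _ omega x.
split=> [k dk|x]; last first.
  split; rewrite odd_pair_class; tfae.
  - by move=> /negP.
  - by move=> /negP /Reeb_vector_exists.
  - by move=> /Reeb_vector_exists.
  - by rewrite negbK.
  - by move=> /(Liouville_vector_exists _ (alt x)).
  - by move=> /(Liouville_vector_exists _ (alt x)); rewrite negbK.
have oddE x : odd k = ~~ (lker (omega x) <= lker (tau x))%VS.
  by rewrite -(dk x) odd_pair_class.
have [x0 _] := M0.
split; tfae.
- by rewrite (oddE x0) => /negP H /Ker_subE/(_ x0).
- move=> H; apply: (Reeb_field_exists dk) => x; rewrite -oddE.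
  apply/negPn/negP => kE; apply: H; apply/Ker_subE => z.
  by move: kE; rewrite (oddE z) negbK.
- move=> [V HV]; rewrite (oddE x0); apply/Reeb_vector_exists.
  by exists (V x0); exact: HV.
- by move=> kE; apply/Ker_subE => z; move: kE; rewrite (oddE z) negbK.
- by move=> /Ker_subE; exact: Liouville_field_exists dk.
- move=> [V HV]; rewrite (oddE x0) negbK.
  by apply/(Liouville_vector_exists _ (alt x0)); exists (V x0); exact: HV.
Qed.
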